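(* Let $\mathcal{A}$ be a unital C$^*$-algebra and let $\mathcal{V}$ be an action of $\Gamma^+$ on $\mathcal{A}$. The following are equivalent: 1) there exists an action $\mathcal{H}$ such that $(\mathcal{V},\mathcal{H})$ is a complete interaction; 2) (i) there exists an action $\mathcal{H}$ such that $(\mathcal{V},\mathcal{H})$ is an interaction, (ii) $\mathcal{V}_x(\mathcal{A})$ and $\mathcal{H}_x(\mathcal{A})$ are hereditary C$^*$-subalgebras of $\mathcal{A}$ for each $x\in\Gamma^+$, and (iii) $\mathcal{V}_x(1)$ and $\mathcal{H}_y(1)$ commute for all $x,y\in\Gamma^+$; 3) (i) for each $x\in\Gamma^+$, $\mathcal{V}_x(1)$ is an orthogonal projection and $\mathcal{V}_x(\mathcal{A})=\mathcal{V}_x(1)\mathcal{A}\mathcal{V}_x(1)$, and (ii) there exists a decreasing family $\{P_x\}_{x\in\Gamma^+}$ of orthogonal projections in $\mathcal{A}$ such that (a) $\mathcal{V}_x(1)$ and $P_y$ commute for all $x,y\in\Gamma^+$, (b) $\mathcal{V}_x(P_{x+y})=\mathcal{V}_x(1)P_y$ for all $x,y\in\Gamma^+$, and (c) for each $x\in\Gamma^+$ the restriction $\mathcal{V}_x:P_x\mathcal{A}P_x\to\mathcal{V}_x(\mathcal{A})$ is a $*$-isomorphism. Moreover, the action $\mathcal{H}$ in 1) and 2) is unique, the family $\{P_x\}$ in 3) is unique, and they are related by $P_x=\mathcal{H}_x(1)$ and $\mathcal{H}_x(a)=\mathcal{V}_x^{-1}(\mathcal{V}_x(1)a\mathcal{V}_x(1))$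 for $a\in\mathcal{A}$, $x\in\Gamma^+$, where $\mathcal{V}_x^{-1}:\mathcal{V}_x(\mathcal{A})\to P_x\mathcal{A}P_x$ is the inverse of the $*$-isomorphism $\mathcal{V}_x:P_x\mathcal{A}P_x\to\mathcal{V}_x(\mathcal{A})$.
   Context: $\Gamma$ is a totally ordered abelian group with identity $0$ and $\Gamma^+=\{x\in\Gamma:0\le x\}$. An action of $\Gamma^+$ on $\mathcal{A}$ is a map $x\mapsto\mathcal{V}_x$ from $\Gamma^+$ into the bounded positive linear maps $\mathcal{A}\to\mathcal{A}$ with $\mathcal{V}_0=\mathrm{Id}$ and $\mathcal{V}_x\circ\mathcal{V}_y=\mathcal{V}_{x+y}$. An interaction is a pair $(\mathcal{V},\mathcal{H})$ of actions such that for every $x\in\Gamma^+$: (i) $\mathcal{V}_x\mathcal{H}_x\mathcal{V}_x=\mathcal{V}_x$; (ii) $\mathcal{H}_x\mathcal{V}_x\mathcal{H}_x=\mathcal{H}_x$; (iii) $\mathcal{V}_x(ab)=\mathcal{V}_x(a)\mathcal{V}_x(b)$ whenever $a$ or $b$ belongs to $\mathcal{H}_x(\mathcal{A})$; (iv) $\mathcal{H}_x(ab)=\mathcal{H}_x(a)\mathcal{H}_x(b)$ whenever $a$ or $b$ belongs to $\mathcal{V}_x(\mathcal{A})$. An interaction is complete if moreover $\mathcal{H}_x(\mathcal{V}_x(a))=\mathcal{H}_x(1)a\mathcal{H}_x(1)$ and $\mathcal{V}_x(\mathcal{H}_x(a))=\mathcal{V}_x(1)a\mathcal{V}_x(1)$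 for all $x\in\Gamma^+$, $a\in\mathcal{A}$, and $\mathcal{H}_y(1)\mathcal{V}_x(1)=\mathcal{V}_x(1)\mathcal{H}_y(1)$ for all $x,y\in\Gamma^+$. *)

(* Defs.v *)
From HB Require Import structures.
From mathcomp Require Import all_boot all_order all_algebra.
From mathcomp Require Import reals.
From mathcomp Require Import complex.
Set Implicit Arguments. Unset Strict Implicit. Unset Printing Implicit Defensive.
Import Order.TTheory GRing.Theory Num.Theory.
Local Open Scope ring_scope.

Definition tot_ord_abelian_group (G : zmodType) (le : rel G) : Prop :=
  [/\ (forall x, le x x),
      (forall x y, le x y -> le y x -> x = y),
      (forall x y z, le x y -> le y z -> le x z),
      (forall x y, le x y \/ le y x)
    & (forall x y z, le x y -> le (x + z) (y + z))].

Section Cstar.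
Variable R : realType.
Local Notation C := (R[i]).
Variable A : algType C.
Variable star : A -> A.
Variable norm : A -> R.

Definition cauchy_seq (u : nat -> A) : Prop :=
  forall e : R, 0 < e -> exists N : nat, forall m n : nat,
    (N <= m)%N -> (N <= n)%N -> norm (u m - u n) < e.

Definition converges_to (u : nat -> A) (l : A) : Prop :=
  forall e : R, 0 < e -> exists N : nat, forall n : nat,
    (N <= n)%N -> norm (u n - l) < e.

Definition unital_Cstar_algebra : Prop := (
  (forall a, star (star a) = a) /\
  (forall a b, star (a + b) = star a + star b) /\
  (forall (c : C) a, star (c *: a) = (conjc c) *: star a) /\
  (forall a b, star (a * b) = star b * star a) /\
  (forall a, norm a = 0 -> a = 0) /\
  (forall a b, norm (a + b) <= norm a + norm b) /\
  (forall (c : C) a, norm (c *: a) = ComplexField.Normc.normc c * norm a) /\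
  (forall a b, norm (a * b) <= norm a * norm b) /\
  (forall a, norm (star a * a) = norm a ^+ 2) /\
  (forall u, cauchy_seq u -> exists l, converges_to u l)).

Definition positive (a : A) : Prop := exists b, a = star b * b.
Definition cle (a b : A) : Prop := positive (b - a).

Definition projection (p : A) : Prop := p * p = p /\ star p = p.

Definition bounded_positive_linear (f : A -> A) : Prop :=
  [/\ (forall (c : C) a b, f (c *: a + b) = c *: f a + f b),
      (exists K : R, forall a, norm (f a) <= K * norm a)
    & (forall a, positive a -> positive (f a))].

Definition range (f : A -> A) (y : A) : Prop := exists a, y = f a.

Definition corner (p : A) (y : A) : Prop := exists a, y = p * a * p.

Definition Cstar_subalgebra (B : A -> Prop) : Prop :=
  [/\ B 0,
      (forall (c : C) a b, B a -> B b -> B (c *: a + b)),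
      (forall a b, B a -> B b -> B (a * b)),
      (forall a, B a -> B (star a))
    & (forall u l, (forall n, B (u n)) -> converges_to u l -> B l)].

Definition hereditary_Cstar_subalgebra (B : A -> Prop) : Prop :=
  Cstar_subalgebra B /\
  (forall a b, B b -> cle 0 a -> cle a b -> B a).

Definition star_iso_on (S T : A -> Prop) (f : A -> A) : Prop := (
  (forall a, S a -> T (f a)) /\
  (forall a b, S a -> S b -> f a = f b -> a = b) /\
  (forall y, T y -> exists2 a, S a & y = f a) /\
  (forall (c : C) a b, S a -> S b -> f (c *: a + b) = c *: f a + f b) /\
  (forall a b, S a -> S b -> f (a * b) = f a * f b) /\
  (forall a, S a -> f (star a) = star (f a))).

Variables (G : zmodType) (le : rel G).
Local Notation nonneg x := (le 0 x).

Definition action (V : G -> A -> A) : Prop :=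
  [/\ (forall x, nonneg x -> bounded_positive_linear (V x)),
      (forall a, V 0 a = a)
    & (forall x y a, nonneg x -> nonneg y -> V x (V y a) = V (x + y) a)].

Definition interaction (V H : G -> A -> A) : Prop :=
  [/\ action V, action H &
   forall x, nonneg x ->
   [/\ (forall a, V x (H x (V x a)) = V x a),
       (forall a, H x (V x (H x a)) = H x a),
       (forall a b, range (H x) a \/ range (H x) b -> V x (a * b) = V x a * V x b)
     & (forall a b, range (V x) a \/ range (V x) b -> H x (a * b) = H x a * H x b)]].

Definition complete_interaction (V H : G -> A -> A) : Prop :=
  [/\ interaction V H,
      (forall x a, nonneg x -> H x (V x a) = H x 1 * a * H x 1),
      (forall x a, nonneg x -> V x (H x a) = V x 1 * a * V x 1)
    & (forall x y, nonneg x -> nonneg y -> H y 1 * V x 1 = V x 1 * H y 1)].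

Definition cond2 (V H : G -> A -> A) : Prop :=
  [/\ interaction V H,
      (forall x, nonneg x ->
         hereditary_Cstar_subalgebra (range (V x)) /\
         hereditary_Cstar_subalgebra (range (H x)))
    & (forall x y, nonneg x -> nonneg y -> V x 1 * H y 1 = H y 1 * V x 1)].

Definition cond3i (V : G -> A -> A) : Prop :=
  forall x, nonneg x ->
    projection (V x 1) /\ (forall y, range (V x) y <-> corner (V x 1) y).

Definition cond3ii (V : G -> A -> A) (P : G -> A) : Prop :=
  [/\ (forall x, nonneg x -> projection (P x)),
      (forall x y, nonneg x -> nonneg y -> le x y -> cle (P y) (P x)),
      (forall x y, nonneg x -> nonneg y -> V x 1 * P y = P y * V x 1),
      (forall x y, nonneg x -> nonneg y -> V x (P (x + y)) = V x 1 * P y)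
    & (forall x, nonneg x -> star_iso_on (corner (P x)) (range (V x)) (V x))].

End Cstar.

(* Main.v *)
(* Call k positive when it is self-adjoint and |t - k| <= t for some t > 0.
   Such elements form a convex cone, and a convergent iteration shows that they
   are exactly the squares of self-adjoint elements; from this one derives that
   the cone is salient and contains every star c * c, without spectral theory.

   Consequently the corner of a projection p is hereditary, and a hereditary
   subalgebra with unit p is the whole corner p A p; this makes 1) and 2)
   equivalent for the same H. Given 1), put P_x = H_x(1). Given 3),
   V_x(P_x) = V_x(1), so the positive map V_x vanishes on (1 - P_x) A by a
   Cauchy-Schwarz argument and is multiplicative as soon as one factor lies in
   P_x A P_x; hence H_x(a) = V_x^-1 (V_x(1) a V_x(1)) forms with V a complete
   interaction. Boundedness of H_x follows from its positivity. *)
From Stdlib Require Import Ncring Ncring_tac.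
Require Import Defs.
From HB Require Import structures.
From mathcomp Require Import all_boot all_order all_algebra.
From mathcomp Require Import reals.
From mathcomp Require Import complex.
From mathcomp Require Import boolp.
From mathcomp Require Import ring lra.
Import Order.TTheory GRing.Theory Num.Theory.
Local Open Scope ring_scope.

(** * Identities in noncommutative rings *)

Section NoncommutativeRing.
Variables (R : realType) (A : algType R[i]).

#[local] Instance alg_ring_ops :
  @Ring_ops A 0 1 +%R *%R (fun x y => x - y) -%R eq := {}.

#[local] Instance alg_ring : @Ring A _ _ _ _ _ _ _ alg_ring_ops.
Proof.
split=> //; try by repeat move=> ? ? ->.
- exact: RelationClasses.eq_equivalence.
- exact: add0r.
- exact: addrC.
- exact: addrA.
- exact: mul1r.
- exact: mulr1.
- exact: mulrA.
- exact: mulrDl.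
- by move=> x y z; exact: mulrDr.
- exact: subrr.
Qed.

End NoncommutativeRing.
#[local] Existing Instances alg_ring_ops alg_ring.

Ltac ncring := non_commutative_ring.

(** * Algebra of the involution and the norm *)

Section CstarAlgebra.
Variables (R : realType) (A : algType R[i]) (star : A -> A) (norm : A -> R).
Hypothesis Cstar : unital_Cstar_algebra star norm.

Local Notation "r *r a" := ((real_complex R r) *: a)
  (at level 40, left associativity).
Local Notation converges := (converges_to norm).
Local Notation selfadj a := (star a = a).

Lemma starK a : star (star a) = a.
Proof. by case: Cstar => H _; apply: H. Qed.

Lemma starD a b : star (a + b) = star a + star b.
Proof. by case: Cstar => _ [H _]; apply: H. Qed.

Lemma starZ c a : star (c *: a) = conjc c *: star a.
Proof. by case: Cstar => _ [_ [H _]]; apply: H. Qed.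

Lemma starM a b : star (a * b) = star b * star a.
Proof. by case: Cstar => _ [_ [_ [H _]]]; apply: H. Qed.

Lemma norm_eq0 a : norm a = 0 -> a = 0.
Proof. by case: Cstar => _ [_ [_ [_ [H _]]]]; apply: H. Qed.

Lemma normD_le a b : norm (a + b) <= norm a + norm b.
Proof. by case: Cstar => _ [_ [_ [_ [_ [H _]]]]]; apply: H. Qed.

Lemma normZ c a : norm (c *: a) = ComplexField.Normc.normc c * norm a.
Proof. by case: Cstar => _ [_ [_ [_ [_ [_ [H _]]]]]]; apply: H. Qed.

Lemma normM_le a b : norm (a * b) <= norm a * norm b.
Proof. by case: Cstar => _ [_ [_ [_ [_ [_ [_ [H _]]]]]]]; apply: H. Qed.

Lemma norm_starM a : norm (star a * a) = norm a ^+ 2.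
Proof. by case: Cstar => _ [_ [_ [_ [_ [_ [_ [_ [H _]]]]]]]]; apply: H. Qed.

Lemma cauchy_converges u : cauchy_seq norm u -> exists l, converges u l.
Proof. by case: Cstar => _ [_ [_ [_ [_ [_ [_ [_ [_ H]]]]]]]]; apply: H. Qed.

Lemma starZr r a : star (r *r a) = r *r star a.
Proof. by rewrite starZ conjc_real. Qed.

Lemma star0 : star 0 = 0.
Proof. by have := starZ 0 0; rewrite !scale0r conjc0 scale0r. Qed.

Lemma starN a : star (- a) = - star a.
Proof. by apply: (addrI (star a)); rewrite -starD !subrr star0. Qed.

Lemma starB a b : star (a - b) = star a - star b.
Proof. by rewrite starD starN. Qed.

Lemma star1 : star 1 = 1.
Proof. by rewrite -[LHS]mul1r -[X in X * _]starK -starM mul1r starK. Qed.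

Lemma normZr r a : norm (r *r a) = `|r| * norm a.
Proof.
by rewrite normZ /= expr0n /= addr0 sqrtr_sqr.
Qed.

Lemma norm0 : norm 0 = 0.
Proof. by rewrite -[0 in LHS](scale0r 0) (normZr 0) normr0 mul0r. Qed.

Lemma norm_i a : norm ('i%C *: a) = norm a.
Proof. by rewrite normZ /= expr0n /= expr1n add0r sqrtr1 mul1r. Qed.

Lemma normN a : norm (- a) = norm a.
Proof.
by rewrite -scaleN1r -[1](rmorph1 (real_complex R)) -rmorphN normZr normrN1 mul1r.
Qed.

Lemma norm_ge0 a : 0 <= norm a.
Proof. by have := normD_le a (- a); rewrite subrr norm0 normN; lra. Qed.

Lemma norm_distC a b : norm (a - b) = norm (b - a).
Proof. by rewrite -normN opprB. Qed.

(** The identity |b|^2 = |star b * b| <= |star b| |b| gives one inequality after cancelling |b|;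
    applied to [star a] it gives the other. *)
Lemma norm_star a : norm (star a) = norm a.
Proof.
have le b : norm b <= norm (star b).
  have [->|nb] := eqVneq (norm b) 0; first exact: norm_ge0.
  have b0 : 0 < norm b by rewrite lt_neqAle eq_sym nb norm_ge0.
  rewrite -(ler_pM2r b0) -expr2 -norm_starM; exact: normM_le.
by apply/eqP; rewrite eq_le le -{2}[a]starK le.
Qed.

Lemma norm_sqr h : selfadj h -> norm (h * h) = norm h ^+ 2.
Proof. by move=> hh; rewrite -norm_starM hh. Qed.

Lemma norm1 : norm 1 = 1.
Proof.
have := norm_sqr _ star1; rewrite mulr1 => /eqP.
rewrite expr2 -[X in X == _]mulr1 -subr_eq0 -mulrBr mulf_eq0 => /orP[|].
  by move=> /eqP/norm_eq0/eqP; rewrite oner_eq0.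
by rewrite subr_eq0 => /eqP.
Qed.

Lemma normX_le a n : norm (a ^+ n) <= norm a ^+ n.
Proof.
elim: n => [|n IH]; first by rewrite !expr0 norm1.
by rewrite !exprS (le_trans (normM_le _ _))// ler_wpM2l ?norm_ge0.
Qed.

Lemma starM_eq0 a : star a * a = 0 -> a = 0.
Proof.
move=> a0; apply: norm_eq0; apply/eqP; rewrite -sqrf_eq0 -norm_starM a0.
by rewrite norm0.
Qed.

Lemma selfadj_sqr_eq0 h : selfadj h -> h * h = 0 -> h = 0.
Proof. by move=> hh h0; apply: starM_eq0; rewrite hh. Qed.

(** * Limits *)

Lemma dist_eq0 a b : (forall e, 0 < e -> norm (a - b) <= e) -> a = b.
Proof.
move=> small; apply/eqP; rewrite -subr_eq0; apply/eqP/norm_eq0.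
apply/eqP; rewrite eq_le norm_ge0 andbT; apply/ler_addgt0Pl => e e0.
by rewrite addr0 small.
Qed.

Lemma converges_lipschitz (f : A -> A) (K : R) u l :
  (forall a b, norm (f a - f b) <= K * norm (a - b)) ->
  converges u l -> converges (f \o u) (f l).
Proof.
move=> fK ul e e0.
(* No sign is assumed on [K], so e is divided by |K| + 1, which is positive. *)
have K0 : 0 < `|K| + 1 by rewrite ltr_wpDl.
have [N HN] := ul (e / (`|K| + 1)) (divr_gt0 e0 K0).
exists N => n /HN; rewrite ltr_pdivlMr// mulrC => lt_e.
apply: le_lt_trans lt_e; apply: le_trans (fK _ _) _.
by rewrite ler_wpM2r ?norm_ge0// (le_trans (ler_norm _))// lerDl.
Qed.

Lemma limit_unique u l m : converges u l -> converges u m -> l = m.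
Proof.
move=> ul um; apply: dist_eq0 => e e0.
have e20 : 0 < e / 2 by rewrite divr_gt0.
have [N HN] := ul _ e20; have [M HM] := um _ e20.
have := HN _ (leq_maxl N M); have := HM _ (leq_maxr N M).
set x := u _ => xm xl.
have -> : l - m = (l - x) + (x - m) by ncring.
by apply: le_trans (normD_le _ _) _; rewrite [norm (l - x)]norm_distC; lra.
Qed.

Lemma converges_ext u v l : u =1 v -> converges u l -> converges v l.
Proof.
by move=> uv ul e /ul[N HN]; exists N => n /HN; rewrite uv.
Qed.

(** Self-adjointness and commutation pass in this way from the square root iterates to their
    limit. *)
Lemma limit_equalizer (f g : A -> A) (K L : R) u l :
  (forall a b, norm (f a - f b) <= K * norm (a - b)) ->
  (forall a b, norm (g a - g b) <= L * norm (a - b)) ->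
  (forall n, f (u n) = g (u n)) -> converges u l -> f l = g l.
Proof.
move=> fK gL fg ul; apply: (@limit_unique (f \o u)).
  exact: converges_lipschitz fK ul.
apply: converges_ext (converges_lipschitz _ _ _ _ gL ul) => n /=.
by rewrite fg.
Qed.

Lemma lipschitz_mull b a a' : norm (b * a - b * a') <= norm b * norm (a - a').
Proof. by rewrite -mulrBr normM_le. Qed.

Lemma lipschitz_mulr b a a' : norm (a * b - a' * b) <= norm b * norm (a - a').
Proof. by rewrite -mulrBl mulrC normM_le. Qed.

Lemma lipschitz_id a a' : norm (a - a') <= 1 * norm (a - a').
Proof. by rewrite mul1r. Qed.

Lemma lipschitz_star a a' : norm (star a - star a') <= 1 * norm (a - a').
Proof. by rewrite -starB norm_star mul1r. Qed.

Lemma norm_limit_le (t : R) u l :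
  (forall n, norm (u n) <= t) -> converges u l -> norm l <= t.
Proof.
move=> ut ul; apply/ler_addgt0Pl => e /ul[N /(_ N (leqnn N))].
have := normD_le (l - u N) (u N); have := ut N.
by rewrite subrK norm_distC; lra.
Qed.

(** With z = h + i k, commutation gives star z * z = h^2 + k^2, while 2 h = z + star z gives |h| <=
    |z|. *)
Lemma norm_sumsq_ge h k : selfadj h -> selfadj k -> h * k = k * h ->
  norm h ^+ 2 <= norm (h * h + k * k).
Proof.
move=> hh kk hk; pose z := h + 'i%C *: k.
have sz : star z = h - 'i%C *: k.
  by rewrite starD starZ hh kk /conjc /= -scaleNr; congr (_ + _ *: _); simpc.
have -> : h * h + k * k = star z * z.
  rewrite sz mulrDr !mulrBl -!scalerAl -!scalerAr scalerA hk.
  have -> : 'i%C * 'i%C = -1 :> R[i] by simpc.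
  by rewrite scaleN1r; ncring.
rewrite norm_starM; apply: lerXn2r; rewrite ?nnegrE ?norm_ge0//.
have zh : z + star z = h + h by rewrite sz /z; ncring.
have hh2 : h + h = 2 *r h by rewrite rmorph_nat scaler_nat mulr2n.
have := normD_le z (star z); rewrite zh hh2 norm_star normZr ger0_norm//; lra.
Qed.

(** * Square roots by iteration *)

Lemma comm_mul_sqr (a b : A) : a * b = b * a -> a * a * b = b * (a * a).
Proof. by move=> ab; rewrite -mulrA ab !mulrA ab. Qed.

(* The iteration y := (a + y^2) / 2 starting at 0 converges to 1 - sqrt (1 - a);
   its increments are dominated by those of the scalar iteration for a = 1. *)
Fixpoint sqrt_iter (a : A) n : A :=
  if n is m.+1 then 2^-1 *r (a + sqrt_iter a m * sqrt_iter a m) else 0.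

Fixpoint sqrt_majorant n : R :=
  if n is m.+1 then 2^-1 * (1 + sqrt_majorant m ^+ 2) else 0.

Lemma sqrt_majorant_ge0 n : 0 <= sqrt_majorant n.
Proof. by case: n => [|n] //=; nra. Qed.

Lemma sqrt_majorant_le1 n : sqrt_majorant n <= 1.
Proof. by elim: n => [|n IH] //=; have := sqrt_majorant_ge0 n; nra. Qed.

(** The distance e to the limit 1 becomes e - e^2 / 2 at each step, so convergence is only of order
    1 / n; this explicit rate makes [sqrt_iter] Cauchy even when |a| = 1. *)
Lemma sqrt_majorant_rate n : 1 - sqrt_majorant n <= 2 / (n.+2)%:R.
Proof.
elim: n => [|n IH] /=; first by rewrite subr0 divff ?pnatr_eq0.
have x0 := sqrt_majorant_ge0 n; have x1 := sqrt_majorant_le1 n.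
have n0 : 0 < n.+2%:R :> R by [].
move: IH; rewrite !ler_pdivlMr// => IH.
rewrite -[n.+3%:R]natr1.
have n1 : 2 <= n.+2%:R :> R by rewrite ler_nat.
set N : R := n.+2%:R in n0 n1 IH *; set x := sqrt_majorant n in x0 x1 IH *.
(* with e = 1 - x: (e - e^2/2)(N+1) <= 2, increasing in e, where e N <= 2 *)
set e := 1 - x in IH; have -> : x = 1 - e by rewrite /e; ring.
have e0 : 0 <= e by rewrite /e; lra.
have e1 : e <= 1 by rewrite /e; lra.
have -> : (1 - 2^-1 * (1 + (1 - e) ^+ 2)) = e - e ^+ 2 / 2 by field.
nra.
Qed.

Lemma norm_sqrt_iter a n : norm a <= 1 -> norm (sqrt_iter a n) <= sqrt_majorant n.
Proof.
move=> a1; elim: n => [|n IH] /=; first by rewrite norm0.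
rewrite normZr ger0_norm ?invr_ge0// ler_pM2l ?invr_gt0//.
apply: le_trans (normD_le _ _) _; apply: lerD => //.
apply: le_trans (normM_le _ _) _.
by rewrite expr2 ler_pM ?norm_ge0.
Qed.

Lemma dist_sqrt_iterS a n : norm a <= 1 ->
  norm (sqrt_iter a n.+1 - sqrt_iter a n)
    <= sqrt_majorant n.+1 - sqrt_majorant n.
Proof.
move=> a1; elim: n => [|n IH].
  by have := norm_sqrt_iter a 1 a1; rewrite /= !subr0.
have yn := norm_sqrt_iter a n a1; have yn1 := norm_sqrt_iter a n.+1 a1.
rewrite [sqrt_iter a n.+2]/= [sqrt_majorant n.+2]/=.
set y := sqrt_iter a n.+1 in IH yn1 *; set z := sqrt_iter a n in IH yn *.
set s := sqrt_majorant n.+1 in IH yn1 *; set t := sqrt_majorant n in IH yn *.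
(* Splitting y^2 - z^2 as y (y - z) + (y - z) z needs no commutation, and s^2 - t^2 split likewise
   bounds it term by term. *)
have -> : 2^-1 *r (a + y * y) - y = 2^-1 *r (y * (y - z) + (y - z) * z).
  rewrite {3}/y /= -/z -scalerBr; congr (_ *: _); ncring.
have -> : 2^-1 * (1 + s ^+ 2) - s = 2^-1 * (s * (s - t) + (s - t) * t).
  by rewrite {2}/s /= -/t; field.
rewrite normZr ger0_norm ?invr_ge0// ler_pM2l ?invr_gt0//.
apply: le_trans (normD_le _ _) _.
by apply: lerD; apply: le_trans (normM_le _ _) _; rewrite ler_pM ?norm_ge0.
Qed.

Lemma dist_sqrt_iter a m n : norm a <= 1 ->
  norm (sqrt_iter a (m + n) - sqrt_iter a n)
    <= sqrt_majorant (m + n) - sqrt_majorant n.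
Proof.
move=> a1; elim: m => [|m IH]; first by rewrite !add0n !subrr norm0.
have := dist_sqrt_iterS a (m + n) a1; rewrite -!addSn.
set y := sqrt_iter a (m + n) in IH *; set z := sqrt_iter a (m.+1 + n).
set w := sqrt_iter a n in IH *.
have := normD_le (z - y) (y - w).
have -> : z - y + (y - w) = z - w by ncring.
lra.
Qed.

Lemma sqrt_iter_cauchy a : norm a <= 1 -> cauchy_seq norm (sqrt_iter a).
Proof.
move=> a1 e e0.
have bound m n : norm (sqrt_iter a (m + n) - sqrt_iter a n) <= 2 / n.+2%:R.
  apply: le_trans (dist_sqrt_iter a m n a1) _.
  by apply: le_trans (sqrt_majorant_rate n); rewrite lerB// sqrt_majorant_le1.
have [N _ HN] : exists2 N : nat, True & 2 / e < N%:R.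
  by exists (Num.trunc (2 / e)).+1 => //; rewrite truncnS_gt.
have small n : (N <= n)%N -> 2 / n.+2%:R < e.
  move=> Nn; rewrite ltr_pdivrMr// mulrC -ltr_pdivrMr//.
  apply: lt_trans HN _.
  by rewrite ltr_nat ltnS (leq_trans Nn)// leqnSn.
exists N => m n Nm Nn; have [mn|nm] := leqP m n.
  by rewrite norm_distC -(subnK mn); apply: le_lt_trans (bound _ _) (small _ Nm).
by rewrite -(subnK (ltnW nm)); apply: le_lt_trans (bound _ _) (small _ Nn).
Qed.

(** The limit y satisfies 2 y = a + y^2, hence (1 - y)^2 = 1 - a. The bound on 1 - r later makes the
    root positive; the last clause makes roots of commuting elements commute. *)
Lemma sqrt_one_sub a : selfadj a -> norm a <= 1 ->
  exists r, [/\ selfadj r, r * r = 1 - a, norm (1 - r) <= 1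
              & forall b, a * b = b * a -> r * b = b * r].
Proof.
move=> sa a1; have [y yl] := cauchy_converges _ (sqrt_iter_cauchy _ a1).
have sn n : star (sqrt_iter a n) = sqrt_iter a n.
  by elim: n => [|n IH] /=; rewrite ?star0// starZr starD starM IH sa.
have sy : selfadj y.
  exact: (limit_equalizer _ _ _ _ _ _ lipschitz_star lipschitz_id sn yl).
have yle u : norm (sqrt_iter a u) <= 1.
  exact: le_trans (norm_sqrt_iter _ _ a1) (sqrt_majorant_le1 _).
have y1 : norm y <= 1 by exact: norm_limit_le yle yl.
have fixy : y = 2^-1 *r (a + y * y).
  apply: dist_eq0 => e e0.
  have e40 : 0 < e / 4 by rewrite divr_gt0.
  have [N HN] := yl _ e40.
  have := HN _ (leqnn N); have /= := HN _ (leqnSn N).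
  set z := sqrt_iter a N => h1 h2.
  have z1 : norm z <= 1 by exact: yle.
  (* The iterate z and its successor are both close to y, and the recursion is 1-Lipschitz on the
     unit ball. *)
  have -> : y - 2^-1 *r (a + y * y) =
      - (2^-1 *r (a + z * z) - y) + 2^-1 *r (z * (z - y) + (z - y) * y).
    have -> : z * (z - y) + (z - y) * y = (a + z * z) - (a + y * y) by ncring.
    by rewrite scalerBr opprB addrA subrK.
  apply: le_trans (normD_le _ _) _.
  rewrite normN normZr ger0_norm ?invr_ge0//.
  have := normD_le (z * (z - y)) ((z - y) * y).
  have := normM_le z (z - y); have := normM_le (z - y) y.
  have zy := norm_ge0 (z - y).
  have : norm z * norm (z - y) <= 1 * norm (z - y) by rewrite ler_wpM2r.
  have : norm (z - y) * norm y <= norm (z - y) * 1 by rewrite ler_wpM2l.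
  by lra.
have y2 : y + y = a + y * y.
  rewrite {1 2}fixy -scalerDl -rmorphD /=.
  have -> : 2^-1 + 2^-1 = 1 :> R by field.
  by rewrite scale1r.
exists (1 - y); split.
- by rewrite starB star1 sy.
- have -> : (1 - y) * (1 - y) = 1 - (y + y) + y * y by ncring.
  by rewrite y2; ncring.
- by have -> : 1 - (1 - y) = y by ncring.
- move=> b ab.
  have cn n : sqrt_iter a n * b = b * sqrt_iter a n.
    elim: n => [|n IH] /=; first by rewrite mul0r mulr0.
    by rewrite -scalerAl -scalerAr mulrDl mulrDr ab comm_mul_sqr.
  have cy : y * b = b * y.
    exact: (limit_equalizer _ _ _ _ _ _
             (lipschitz_mulr b) (lipschitz_mull b) cn yl).
  by rewrite mulrBl mulrBr cy mul1r mulr1.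
Qed.


(** * The positive cone *)

Lemma conj_i : conjc 'i%C = - 'i%C :> R[i].
Proof. by apply/eqP; rewrite eq_complex /= oppr0 !eqxx. Qed.

(** For self-adjoint k the bound says that the spectrum lies in [0, 2t]; in this form, closure under
    sums is the triangle inequality. *)
Definition pos (k : A) : Prop :=
  selfadj k /\ exists2 t : R, 0 < t & norm (t *r 1 - k) <= t.

Lemma scale_realA (s t : R) (a : A) : s *r (t *r a) = (s * t) *r a.
Proof. by rewrite scalerA -rmorphM. Qed.

Lemma scale_realK (t : R) (a : A) : t != 0 -> t *r (t^-1 *r a) = a.
Proof. by move=> t0; rewrite scale_realA divff// scale1r. Qed.

Lemma scale_real_nat n (a : A) : n%:R *r a = a *+ n.
Proof. by rewrite rmorph_nat scaler_nat. Qed.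

(** For g = h / sqrt t, the root r of 1 - g^2 commutes with g, so |r|^2 <= |r^2 + g^2| = 1; and t -
    h^2 = t r^2. *)
Lemma norm_sub_sqr_le h t : selfadj h -> 0 < t -> norm h ^+ 2 <= t ->
  norm (t *r 1 - h * h) <= t.
Proof.
move=> hh t0 ht; pose g := (Num.sqrt t)^-1 *r h.
have st0 : 0 < Num.sqrt t by rewrite sqrtr_gt0.
have gg : g * g = t^-1 *r (h * h).
  rewrite /g -scalerAl -scalerAr scale_realA -invfM -expr2 sqr_sqrtr//.
  exact: ltW.
have sg : selfadj g by rewrite starZr hh.
have [||r [sr rr _ rc]] := sqrt_one_sub (g * g).
- by rewrite starM sg.
- by rewrite gg normZr normfV gtr0_norm// norm_sqr// mulrC ler_pdivrMr// mul1r.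
have rg : r * g = g * r by apply: rc; rewrite mulrA.
have := norm_sumsq_ge r g sr sg rg.
have -> : r * r + g * g = 1 by rewrite rr; ncring.
rewrite norm1 -norm_sqr// => r1.
have -> : t *r 1 - h * h = t *r (r * r).
  by rewrite rr gg scalerBr scale_realK// gt_eqF.
by rewrite normZr gtr0_norm// ler_piMr// ltW.
Qed.

Lemma pos_sqr h : selfadj h -> pos (h * h).
Proof.
move=> hh; split; first by rewrite starM hh.
have t0 : 0 < norm h ^+ 2 + 1 by rewrite ltr_wpDl// exprn_ge0// norm_ge0.
by exists (norm h ^+ 2 + 1) => //; apply: norm_sub_sqr_le => //; rewrite lerDl.
Qed.

(** Write k = t (1 - a) with |a| <= 1 and let r be the root of 1 - a. The root of k is sqrt t times
    r, and |1 - r| <= 1 makes it positive with radius sqrt t. *)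
Lemma pos_sqrt k : pos k -> exists r, [/\ pos r, r * r = k
  & forall b, k * b = b * k -> r * b = b * r].
Proof.
move=> [kk [t t0 tk]].
have nt0 : t != 0 by rewrite gt_eqF.
have st0 : 0 < Num.sqrt t by rewrite sqrtr_gt0.
pose a := 1 - t^-1 *r k.
have sa : selfadj a by rewrite starB star1 starZr kk.
have ka : t *r a = t *r 1 - k by rewrite scalerBr scale_realK.
have [|r [sr rr r1 rc]] := sqrt_one_sub a sa.
  by rewrite -(ler_pM2l t0) mulr1 -{1}(gtr0_norm t0) -normZr ka.
exists (Num.sqrt t *r r); split.
- split; first by rewrite starZr sr.
  exists (Num.sqrt t) => //.
  by rewrite -scalerBr normZr gtr0_norm// ler_piMr// ltW.
- rewrite -scalerAl -scalerAr scale_realA -expr2 sqr_sqrtr ?ltW// rr.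
  by rewrite scalerBr ka subKr.
- move=> b kb; rewrite -scalerAl -scalerAr rc// mulrBl mulrBr -scalerAl kb.
  by rewrite scalerAr mul1r mulr1.
Qed.

Lemma pos_selfadj k : pos k -> selfadj k. Proof. by case. Qed.

(** Once k is a square, every positive t >= |k| can serve as radius, not only the one stored in
    [pos]; [pos_limit_shift] relies on this uniformity. *)
Lemma pos_norm_sub k t : pos k -> 0 < t -> norm k <= t -> norm (t *r 1 - k) <= t.
Proof.
by move=> /pos_sqrt[r [[sr _] <- _]] t0; rewrite norm_sqr//; exact: norm_sub_sqr_le.
Qed.

Lemma pos1 : pos 1.
Proof. by rewrite -[1]mulr1; apply: pos_sqr; exact: star1. Qed.

Lemma pos0 : pos 0.
Proof. by rewrite -[0](mulr0 0); apply: pos_sqr; exact: star0. Qed.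

Lemma posD j k : pos j -> pos k -> pos (j + k).
Proof.
move=> [jj [s s0 sj]] [kk [t t0 tk]]; split; first by rewrite starD jj kk.
exists (s + t); first exact: addr_gt0.
rewrite rmorphD scalerDl opprD addrACA.
by apply: le_trans (normD_le _ _) _; exact: lerD.
Qed.

Lemma posZ (s : R) k : 0 < s -> pos k -> pos (s *r k).
Proof.
move=> s0 [kk [t t0 tk]]; split; first by rewrite starZr kk.
exists (s * t); first exact: mulr_gt0.
by rewrite -scale_realA -scalerBr normZr gtr0_norm// ler_pM2l.
Qed.

Lemma posMn k n : pos k -> pos (k *+ n).
Proof.
by move=> k0; elim: n => [|n IH]; rewrite ?mulr0n ?mulrS; [exact: pos0|exact: posD].
Qed.

Lemma pos_sqrt2 j k : pos j -> pos k -> j * k = k * j -> exists r s,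
  [/\ selfadj r, selfadj s, r * r = j, s * s = k & r * s = s * r].
Proof.
move=> /pos_sqrt[r [[sr _] rr rc]] /pos_sqrt[s [[ss _] sk sc]] jk.
by exists r, s; split => //; rewrite sc// rc.
Qed.

(** Commuting square roots r and s turn j k into the square of the self-adjoint element r s. *)
Lemma posM j k : pos j -> pos k -> j * k = k * j -> pos (j * k).
Proof.
move=> j0 k0 /(pos_sqrt2 _ _ j0 k0)[r [s [sr ss <- <- rs]]].
have -> : r * r * (s * s) = (r * s) * (r * s).
  by rewrite -!mulrA; congr (_ * _); rewrite !mulrA -rs.
by apply: pos_sqr; rewrite starM ss sr rs.
Qed.

Lemma norm_pos_le j k : pos j -> pos k -> j * k = k * j -> norm j <= norm (j + k).
Proof.
move=> j0 k0 /(pos_sqrt2 _ _ j0 k0)[r [s [sr ss <- <- rs]]].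
by rewrite norm_sqr// norm_sumsq_ge.
Qed.

(** The remainder c gathers the terms of degree at least 2; it commutes with b so that c b stays
    positive in the induction. *)
Lemma pos_binomial b n : pos b ->
  exists2 c, pos c /\ c * b = b * c & (1 + b) ^+ n = 1 + b *+ n + c.
Proof.
move=> b0; elim: n => [|n [c [c0 cb] IH]].
  exists 0; first by split; [exact: pos0|rewrite mul0r mulr0].
  by rewrite expr0 mulr0n !addr0.
exists ((b * b) *+ n + c + c * b).
  split; last by rewrite !mulrDl !mulrDr mulrnAl mulrnAr !mulrA cb.
  apply: posD (posM _ _ c0 b0 cb); apply: posD c0; apply: posMn.
  exact: pos_sqr (pos_selfadj _ b0).
by rewrite exprSr IH -mulrnAl mulrS; move: (b *+ n) => d; ncring.
Qed.

(* If b and -b are positive then |1 + b / t| <= 1 for some t > 0, whereas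
   n |b / t| <= |(1 + b / t) ^ n| by the binomial expansion. *)
Lemma pos_antisym b : pos b -> pos (- b) -> b = 0.
Proof.
move=> b0 [_ [t t0]]; rewrite opprK => tb.
have nt0 : t != 0 by rewrite gt_eqF.
pose d := t^-1 *r b.
have d0 : pos d by apply: posZ => //; rewrite invr_gt0.
have d1 : norm (1 + d) <= 1.
  rewrite -(ler_pM2l t0) mulr1 -{1}(gtr0_norm t0) -normZr scalerDr.
  by rewrite scale_realK.
have nd n : n%:R * norm d <= 1.
  have [c [c0 cd] dn] := pos_binomial d n d0.
  apply: (@le_trans _ _ (norm ((1 + d) ^+ n))); last first.
    by apply: le_trans (normX_le _ _) _; rewrite exprn_ile1// norm_ge0.
  have -> : n%:R * norm d = norm (d *+ n).
    by rewrite -scale_real_nat normZr normr_nat.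
  rewrite dn addrAC addrC; apply: norm_pos_le.
  - exact: posMn.
  - by apply: posD => //; exact: pos1.
  - by rewrite mulrDl mulrDr mul1r mulr1 mulrnAl mulrnAr cd.
have d00 : norm d = 0.
  apply/eqP; rewrite eq_le norm_ge0 andbT leNgt; apply/negP => dp.
  have := nd (Num.trunc (norm d)^-1).+1; rewrite leNgt => /negP; apply.
  by rewrite -ltr_pdivrMr// mul1r truncnS_gt.
by rewrite -[b](scale_realK t)// -/d (norm_eq0 _ d00) scaler0.
Qed.

(* Write x' for star x. With m = d c' both m' m = -(c c')^2 and
   m m' = -(d d')^2, while 2 (m' m + m m') is a sum of two squares of
   self-adjoint elements. *)
Lemma starM_add_eq0 c d : star c * c + star d * d = 0 -> c = 0.
Proof.
move=> cd0; pose m := d * star c.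
pose X := m + star m; pose Y := 'i%C *: (m - star m).
pose k := c * star c; pose l := d * star d.
have sk : selfadj k by rewrite starM starK.
have sl : selfadj l by rewrite starM starK.
have sX : selfadj X by rewrite starD starK addrC.
have sY : selfadj Y by rewrite starZ starB starK conj_i scaleNr -scalerN opprB.
have ddcc : star d * d = - (star c * c) by apply/eqP; rewrite -addr_eq0 addrC cd0.
have ccdd : star c * c = - (star d * d) by rewrite ddcc opprK.
have mm : star m * m = - (k * k).
  rewrite /m starM starK -mulrA (mulrA (star d)) ddcc /k.
  by rewrite mulNr mulrN !mulrA.
have mm' : m * star m = - (l * l).
  rewrite /m starM starK -mulrA (mulrA (star c)) ccdd /l.
  by rewrite mulNr mulrN !mulrA.
have XY : X * X + Y * Y = (star m * m + m * star m) *+ 2.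
  rewrite /Y -scalerAl -scalerAr scalerA -(expr2 'i%C) sqr_i scaleN1r /X mulr2n.
  ncring.
have kk0 : (k * k) *+ 2 = 0.
  apply: pos_antisym; first by apply: posMn; exact: pos_sqr.
  have -> : - (k * k *+ 2) = X * X + Y * Y + (l * l) *+ 2.
    by rewrite XY mm mm' !mulr2n; ncring.
  by apply: posD; [apply: posD; exact: pos_sqr|apply: posMn; exact: pos_sqr].
have : k * k = 0.
  have half : k * k = 2^-1 *r ((k * k) *+ 2).
    rewrite -scale_real_nat scale_realA.
    by rewrite mulVf ?pnatr_eq0// scale1r.
  by rewrite half kk0 scaler0.
move=> /(selfadj_sqr_eq0 _ sk) k0.
have : star c = 0 by apply: starM_eq0; rewrite starK.
by move=> c0; rewrite -[c]starK c0 star0.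
Qed.

(* For a = star c * c and r = |a|, the element m = c * (r - a) satisfies
   star m * m = - (r - a) * r * (r - a), hence vanishes. *)
Lemma pos_starM c : pos (star c * c).
Proof.
pose a := star c * c.
have sa : selfadj a by rewrite starM starK.
have [r [r0 rr rc]] := pos_sqrt _ (pos_sqr _ sa).
have ra : r * a = a * r by apply: rc; rewrite mulrA.
have [s [s0 ssr sc]] := pos_sqrt _ r0.
have sr := pos_selfadj _ r0; have ss := pos_selfadj _ s0.
pose w := r - a.
have sw : selfadj w by rewrite starB sr sa.
have aw : a * w = - (r * w).
  by rewrite !mulrBr -rr ra; ncring.
have rw : r * w = w * r by rewrite mulrBl mulrBr ra.
have sws : s * w = w * s by apply: sc.
have cw0 : c * w = 0.
  apply: (starM_add_eq0 _ (s * w)).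
  rewrite !starM sw ss -mulrA (mulrA (star c)) -/a aw -ssr.
  by rewrite mulrN !mulrA addNr.
have aw0 : a * w = 0 by rewrite -mulrA cw0 mulr0.
have ww : w * w = 0.
  by rewrite {1}/w mulrBl aw0 subr0 -[r * w]opprK -aw aw0 oppr0.
have /eqP := selfadj_sqr_eq0 _ sw ww; rewrite subr_eq0 => /eqP ar.
by rewrite -/a -ar.
Qed.

Lemma positiveP k : positive star k <-> pos k.
Proof.
split=> [[c ->]|/pos_sqrt[r [[sr _] <- _]]]; first exact: pos_starM.
by exists r; rewrite sr.
Qed.

(** For all small e the elements e B + g share the radius T, by [pos_norm_sub]; letting e tend to 0
    gives |T - g| <= T. *)
Lemma pos_limit_shift B g : pos B -> selfadj g ->
  (forall e : R, 0 < e -> pos (e *r B + g)) -> pos g.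
Proof.
move=> B0 sg pg; split => //; pose T := norm B + norm g + 1.
have B1 := norm_ge0 B; have g1 := norm_ge0 g.
have T0 : 0 < T by rewrite /T; lra.
exists T => //; apply/ler_addgt0Pl => e e0.
(* The cap 1 keeps |f B + g| below T; the quotient makes f |B| at most e. *)
pose f := Num.min 1 (e / (norm B + 1)).
have nB1 : 0 < norm B + 1 by lra.
have f0 : 0 < f by rewrite lt_min ltr01 divr_gt0.
have fB : f * norm B <= e.
  apply: (@le_trans _ _ (e / (norm B + 1) * (norm B + 1)));
    last by rewrite divfK// gt_eqF.
  by apply: ler_pM => //; [exact: ltW|rewrite ge_min lexx orbT|lra].
have fB1 : f * norm B <= norm B by rewrite ler_piMl// ge_min lexx.
have nfB : norm (f *r B) = f * norm B by rewrite normZr gtr0_norm.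
have := pos_norm_sub _ T (pg f f0) T0.
have /[swap] /[apply] : norm (f *r B + g) <= T.
  by apply: le_trans (normD_le _ _) _; rewrite nfB /T; lra.
have := normD_le (T *r 1 - (f *r B + g)) (f *r B).
have -> : T *r 1 - (f *r B + g) + f *r B = T *r 1 - g by ncring.
rewrite nfB; lra.
Qed.

Lemma scale_half (a : A) : 2^-1 *r (a + a) = a.
Proof.
by rewrite -mulr2n -scale_real_nat scale_realA mulVf ?pnatr_eq0// scale1r.
Qed.

Lemma cartesian a : exists x y, [/\ selfadj x, selfadj y, a = x + 'i%C *: y,
  norm x <= norm a & norm y <= norm a].
Proof.
have le_half b : norm b <= norm a + norm a -> norm (2^-1 *r b) <= norm a.
  by rewrite normZr ger0_norm ?invr_ge0//; lra.
exists (2^-1 *r (a + star a)), (2^-1 *r ('i%C *: (star a - a))); split.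
- by rewrite starZr starD starK addrC.
- by rewrite starZr starZ starB starK conj_i scaleNr -scalerN opprB.
- rewrite (scalerA 'i%C) (mulrC 'i%C) -scalerA (scalerA 'i%C 'i%C)
    -(expr2 'i%C) sqr_i.
  rewrite scaleN1r -scalerDr.
  have -> : a + star a - (star a - a) = a + a by ncring.
  by rewrite scale_half.
- by apply: le_half; apply: le_trans (normD_le _ _) _; rewrite norm_star.
- apply: le_half; rewrite norm_i; apply: le_trans (normD_le _ _) _.
  by rewrite normN norm_star.
Qed.

Lemma pos_one_sub k : selfadj k -> norm k <= 1 -> pos (1 - k).
Proof.
move=> kk k1; split; first by rewrite starB star1 kk.
by exists 1 => //; rewrite scale1r subKr.
Qed.

(** * Positive linear maps *)

Section PositiveMap.
Variable f : A -> A.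
Hypothesis f_lin : forall (c : R[i]) a b, f (c *: a + b) = c *: f a + f b.

Lemma linear_mapD a b : f (a + b) = f a + f b.
Proof. by have := f_lin 1 a b; rewrite !scale1r. Qed.

Lemma linear_map0 : f 0 = 0.
Proof.
by apply/eqP; rewrite -(inj_eq (addrI (f 0))) -linear_mapD !addr0.
Qed.

Lemma linear_mapZ c a : f (c *: a) = c *: f a.
Proof. by have := f_lin c a 0; rewrite linear_map0 !addr0. Qed.

Lemma linear_mapN a : f (- a) = - f a.
Proof. by rewrite -scaleN1r linear_mapZ scaleN1r. Qed.

Lemma linear_mapB a b : f (a - b) = f a - f b.
Proof. by rewrite linear_mapD linear_mapN. Qed.

Hypothesis f_pos : forall a, pos a -> pos (f a).

Lemma positive_map_selfadj h : selfadj h -> selfadj (f h).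
Proof.
move=> hh; have h1 : selfadj (1 + h) by rewrite starD star1 hh.
rewrite -[h]scale_half.
(* This writes 2 h as a combination of positive elements, whose images are self-adjoint. *)
have -> : h + h = (1 + h) * (1 + h) - h * h - 1 by ncring.
rewrite linear_mapZ !linear_mapB starZr !starB.
by rewrite !pos_selfadj//; apply: f_pos; [exact: pos1|exact: pos_sqr..].
Qed.

Lemma positive_map_star a : f (star a) = star (f a).
Proof.
have [x [y [sx sy -> _ _]]] := cartesian a.
rewrite starD starZ sx sy !linear_mapD !linear_mapZ starD starZ.
by rewrite !positive_map_selfadj.
Qed.

(** Scale to |h| = 1. Then 1 - f h and 1 + f h are positive and commute, so their product 1 - (f
    h)^2 is positive; it adds up with (f h)^2 to 1, whence |f h|^2 <= 1. *)
Lemma positive_map_norm_selfadj h : pos (1 - f 1) -> selfadj h ->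
  norm (f h) <= norm h.
Proof.
move=> f1 hh; wlog nh1 : h hh / norm h = 1 => [contr|].
  have [h0|h0] := eqVneq (norm h) 0.
    by rewrite (norm_eq0 _ h0) linear_map0.
  have hp : 0 < norm h by rewrite lt_neqAle eq_sym h0 norm_ge0.
  pose k := (norm h)^-1 *r h.
  have nk : norm k = 1 by rewrite normZr gtr0_norm ?invr_gt0// mulVf.
  have := contr k; rewrite starZr hh nk linear_mapZ normZr gtr0_norm ?invr_gt0//.
  by move=> /(_ erefl erefl); rewrite mulrC ler_pdivrMr// mul1r.
have shift k : selfadj k -> norm k <= 1 -> pos (1 - f k).
  move=> kk k1; have -> : 1 - f k = (1 - f 1) + f (1 - k).
    by rewrite linear_mapB; ncring.
  by apply: posD => //; exact/f_pos/pos_one_sub.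
have pm : pos (1 - f h) by apply: shift; rewrite ?nh1.
have pp : pos (1 + f h).
  by rewrite -[f h]opprK -linear_mapN; apply: shift; rewrite ?starN ?hh ?normN ?nh1.
have pmp : pos ((1 - f h) * (1 + f h)) by apply: posM => //; ncring.
have sfh := positive_map_selfadj _ hh.
have := norm_pos_le (f h * f h) ((1 - f h) * (1 + f h)) (pos_sqr _ sfh) pmp.
have -> : f h * f h + (1 - f h) * (1 + f h) = 1 by ncring.
have /[swap] /[apply] :
    f h * f h * ((1 - f h) * (1 + f h)) = (1 - f h) * (1 + f h) * (f h * f h).
  by ncring.
rewrite norm1 norm_sqr// nh1 => fh1.
by rewrite -(@ler_pXn2r _ 2) ?nnegrE ?norm_ge0// expr1n.
Qed.

Lemma positive_map_bounded : pos (1 - f 1) ->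
  exists K : R, forall a, norm (f a) <= K * norm a.
Proof.
(* The real and imaginary parts contribute at most |a| each. *)
move=> f1; exists 2 => a.
have [x [y [sx sy -> nx ny]]] := cartesian a.
rewrite linear_mapD linear_mapZ; apply: le_trans (normD_le _ _) _.
have := positive_map_norm_selfadj _ f1 sx.
by have := positive_map_norm_selfadj _ f1 sy; rewrite norm_i; lra.
Qed.

Section Kernel.
Variable q : A.
Hypotheses (q_proj : projection star q) (fq0 : f q = 0).

(* Positivity of f on star (q + e b) * (q + e b), divided by e. *)
Lemma positive_map_kernel_re b : f (q * b) + star (f (q * b)) = 0.
Proof.
case: q_proj => qq sq.
have half c : pos (f (q * c) + star (f (q * c))).
  apply: (@pos_limit_shift (f (star c * c))).
  - exact/f_pos/pos_starM.
  - by rewrite starD starK addrC.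
  - move=> e e0; have ne0 : e != 0 by rewrite gt_eqF.
    have -> : e *r f (star c * c) + (f (q * c) + star (f (q * c))) =
        e^-1 *r f (star (q + e *r c) * (q + e *r c)).
      rewrite starD starZr sq mulrDl !mulrDr -!scalerAl -!scalerAr qq.
      rewrite !linear_mapD !linear_mapZ fq0 !scalerDr scaler0 add0r.
      rewrite !scale_realA mulVf// mul1r !scale1r.
      by rewrite -positive_map_star starM sq; ncring.
    apply: posZ; first by rewrite invr_gt0.
    exact/f_pos/pos_starM.
apply: pos_antisym; first exact: half.
by have := half (- b); rewrite mulrN linear_mapN starN -opprD.
Qed.

(** [positive_map_kernel_re] makes f (q b) skew-adjoint when used at b, and self-adjoint when used
    at i b. *)
Lemma positive_map_kernel b : f (q * b) = 0.
Proof.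
have := positive_map_kernel_re ('i%C *: b).
rewrite -scalerAr linear_mapZ starZ conj_i scaleNr -scalerBr => /(congr1 norm).
rewrite norm_i norm0 => /norm_eq0/eqP; rewrite subr_eq0 => /eqP e.
have := positive_map_kernel_re b; rewrite -e => e0.
by rewrite -[LHS]scale_half e0 scaler0.
Qed.

End Kernel.
End PositiveMap.

(** * Projections, corners and hereditary subalgebras *)

Lemma projection_compl p : projection star p -> projection star (1 - p).
Proof.
case=> pp sp; split; last by rewrite starB star1 sp.
have -> : (1 - p) * (1 - p) = 1 - p - p + p * p by ncring.
by rewrite pp subrK.
Qed.

Lemma projection_pos p : projection star p -> pos p.
Proof. by case=> pp sp; rewrite -pp; exact: pos_sqr. Qed.

Lemma cornerP p y : projection star p -> corner p y <-> p * y * p = y.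
Proof.
case=> pp _; split=> [[a ->]|<-]; last by exists y.
by rewrite !mulrA pp -!mulrA pp.
Qed.

Lemma corner_mull p y : projection star p -> p * y * p = y -> p * y = y.
Proof. by move=> [pp _] e; rewrite -[in LHS]e !mulrA pp. Qed.

Lemma corner_mulr p y : projection star p -> p * y * p = y -> y * p = y.
Proof. by move=> [pp _] e; rewrite -[in LHS]e -!mulrA pp mulrA. Qed.

(** For x = (1 - e) p, star x * x = p (1 - e) p = 0, so x = 0. *)
Lemma projection_sandwich p e : projection star p -> projection star e ->
  p * e * p = p -> e * p = p.
Proof.
move=> [pp sp] pe pep; have [ee se] := projection_compl _ pe.
have : (1 - e) * p = 0.
  apply: starM_eq0; rewrite starM se sp mulrA -(mulrA p) ee.
  by rewrite mulrBr mulrBl mulr1 pp pep subrr.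
by rewrite mulrBl mul1r => /eqP; rewrite subr_eq0 eq_sym => /eqP.
Qed.

(** Compress p - e = star b * b by q = 1 - p: the star squares of e q and b q add up to 0, so e q =
    0. *)
Lemma cle_projection p e : projection star p -> projection star e ->
  cle star e p -> e * p = e /\ p * e = e.
Proof.
move=> [pp sp] [ee se] [b pe].
have [qq sq] := projection_compl p (conj pp sp); set q := 1 - p in qq sq.
have qp : q * p = 0 by rewrite mulrBl mul1r pp subrr.
have eq0 : e * q = 0.
  apply: (starM_add_eq0 _ (b * q)).
  rewrite !starM sq se !mulrA -(mulrA q e e) ee -(mulrA q _ b) -pe.
  by rewrite (mulrBr q p) qp sub0r; ncring.
have ep : e * p = e.
  by move: eq0; rewrite mulrBr mulr1 => /eqP; rewrite subr_eq0 eq_sym => /eqP.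
by split=> //; have := congr1 star ep; rewrite starM sp se.
Qed.

Lemma projection_cle p e : projection star p -> projection star e ->
  p * e = e -> cle star e p.
Proof.
(* The difference p - e is itself a projection, hence its own star square. *)
move=> [pp sp] [ee se] pe; exists (p - e).
have ep : e * p = e by have := congr1 star pe; rewrite starM sp se.
by rewrite starB sp se mulrBl !mulrBr pp pe ep ee subrr subr0.
Qed.

Lemma hereditary_corner p (B : A -> Prop) : projection star p ->
  (forall y, B y <-> p * y * p = y) ->
  hereditary_Cstar_subalgebra star norm B.
Proof.
move=> pr BP; have [pp sp] := pr; split.
  split.
  - by apply/BP; rewrite mulr0 mul0r.
  - move=> c a b /BP pa /BP pb; apply/BP.
    by rewrite mulrDr mulrDl -scalerAr -scalerAl pa pb.
  - move=> a b /BP pa /BP pb; apply/BP.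
    by rewrite mulrA (corner_mull p a)// -mulrA (corner_mulr p b).
  - by move=> a /BP pa; apply/BP; rewrite -[in RHS]pa !starM sp mulrA.
  - move=> u l Bu ul; apply/BP.
    have lip a b : norm (p * a * p - p * b * p) <= norm p * norm p * norm (a - b).
      rewrite -mulrBl -mulrBr mulrAC; apply: le_trans (normM_le _ _) _.
      by rewrite ler_wpM2r ?norm_ge0// normM_le.
    apply: (limit_equalizer _ _ _ _ _ _ lip lipschitz_id _ ul) => n.
    by apply/BP.
(* Heredity: a and b - a are the star squares of e and f. Compressed by q = 1 - p they add up to q b
   q = 0, so e q = 0. *)
move=> a b /BP pb [e]; rewrite subr0 => ae [f bf]; apply/BP.
have [qq sq] := projection_compl p pr; set q := 1 - p in qq sq.
have qp : q * p = 0 by rewrite mulrBl mul1r pp subrr.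
have eq0 : e * q = 0.
  apply: (starM_add_eq0 _ (f * q)).
  rewrite !starM sq !mulrA -(mulrA q _ e) -ae -(mulrA q _ f) -bf.
  have -> : q * a * q + q * (b - a) * q = q * b * q by ncring.
  by rewrite -pb !mulrA qp !mul0r.
have ep : e * p = e.
  by move: eq0; rewrite mulrBr mulr1 => /eqP; rewrite subr_eq0 eq_sym => /eqP.
by rewrite ae -mulrA -mulrA ep mulrA -sp -starM ep.
Qed.

Lemma pos_conj p k : selfadj p -> pos k -> positive star (p * k * p).
Proof.
move=> sp /pos_sqrt[r [[sr _] <- _]]; exists (r * p).
by rewrite starM sp sr !mulrA.
Qed.

(** For self-adjoint a in the unit ball, 0 <= p (1 + a) p <= 2 p, so heredity captures p (1 + a) p
    and hence p a p. Scaling and the Cartesian decomposition reach every a. *)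
Lemma corner_sub_hereditary p (B : A -> Prop) : projection star p ->
  hereditary_Cstar_subalgebra star norm B -> B p -> forall a, B (p * a * p).
Proof.
move=> [pp sp] [[B0 Blin BM Bstar _] Bher] Bp.
have BD a b : B a -> B b -> B (a + b).
  by move=> Ba Bb; have := Blin 1 a b Ba Bb; rewrite scale1r.
have BZ c a : B a -> B (c *: a).
  by move=> Ba; have := Blin c a 0 Ba B0; rewrite addr0.
have unit_ball a : selfadj a -> norm a <= 1 -> B (p * a * p).
  move=> sa a1.
  have pap : p * a * p = (-1) *: p + p * (1 - - a) * p.
    by rewrite scaleN1r mulrBr mulrBl mulr1 pp; ncring.
  rewrite pap; apply: Blin => //.
  apply: (Bher _ (p + p)); first exact: BD.
    rewrite /cle subr0; apply: pos_conj => //.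
    by apply: pos_one_sub; rewrite ?starN ?sa ?normN.
  rewrite /cle; have -> : p + p - p * (1 - - a) * p = p * (1 - a) * p.
    by rewrite !mulrBr !mulrBl mulr1 pp; ncring.
  by apply: pos_conj => //; exact: pos_one_sub.
have Bsa a : selfadj a -> B (p * a * p).
  move=> sa; pose t := norm a + 1.
  have t0 : 0 < t by rewrite ltr_wpDl// norm_ge0.
  rewrite -[a](scale_realK t) ?gt_eqF// -scalerAr -scalerAl; apply: BZ.
  apply: unit_ball; first by rewrite starZr sa.
  by rewrite normZr gtr0_norm ?invr_gt0// mulrC ler_pdivrMr// mul1r lerDl.
move=> a; have [x [y [sx sy -> _ _]]] := cartesian a.
rewrite mulrDr mulrDl -scalerAr -scalerAl.
by apply: (BD); [exact: Bsa|apply: BZ; exact: Bsa].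
Qed.

(** * The pair of maps at a fixed group element *)

Local Notation bounded_positive := (bounded_positive_linear star norm).

Lemma bounded_positive_pos f : bounded_positive f -> forall a, pos a -> pos (f a).
Proof. by case=> _ _ f_pos a /positiveP/f_pos/positiveP. Qed.

Lemma bounded_positive_lin f : bounded_positive f ->
  forall (c : R[i]) a b, f (c *: a + b) = c *: f a + f b.
Proof. by case. Qed.

Section InteractionPair.
Variables f g : A -> A.
Hypotheses (fb : bounded_positive f) (fgf : forall a, f (g (f a)) = f a)
  (gfg : forall a, g (f (g a)) = g a)
  (fM : forall a b, range g a \/ range g b -> f (a * b) = f a * f b).

(** Since f a = f (g (f a)), apply multiplicativity to the factors 1 and g (f a), the latter in the
    range of g. *)
Lemma pair_unitl a : f 1 * f a = f a.
Proof. by rewrite -{1}[f a]fgf -fM ?mul1r ?fgf//; right; exists (f a). Qed.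

Lemma pair_unitr a : f a * f 1 = f a.
Proof. by rewrite -{1}[f a]fgf -fM ?mulr1 ?fgf//; left; exists (f a). Qed.

Lemma pair_projection : projection star (f 1).
Proof.
split; first exact: pair_unitl.
by apply/pos_selfadj/(bounded_positive_pos _ fb)/pos1.
Qed.

Lemma pair_inj u v : range g u -> range g v -> f u = f v -> u = v.
Proof. by move=> [a ->] [b ->] e; rewrite -[LHS]gfg e gfg. Qed.

(** f (g 1) = f (g 1) f 1 = f (g 1) f (g (f 1)) = f (g 1 * g (f 1)) = f (g (f 1)) = f 1. *)
Lemma pair_map_unit : (forall a, g 1 * g a = g a) -> f (g 1) = f 1.
Proof.
move=> g1; rewrite -pair_unitr -{1}[f 1]fgf -fM; last by left; exists 1.
by rewrite g1 fgf.
Qed.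

Lemma complete_range y : (forall a, f (g a) = f 1 * a * f 1) ->
  range f y <-> f 1 * y * f 1 = y.
Proof.
move=> fg; split=> [[a ->]|<-]; first by rewrite pair_unitl pair_unitr.
by exists (g y); rewrite fg.
Qed.

(** Both sides lie in the range of g, where f is injective, and f sends both to f a. *)
Lemma hereditary_complete : (forall a, g 1 * g a = g a) ->
  (forall a, range g (g 1 * a * g 1)) -> forall a, g (f a) = g 1 * a * g 1.
Proof.
move=> g1 rg a; apply: pair_inj => //; first by exists (f a).
have r1 : range g (g 1) by exists 1.
by rewrite fgf !fM ?pair_map_unit ?pair_unitl ?pair_unitr//; [left|right].
Qed.

End InteractionPair.

(** * Interactions: 1) and 2), uniqueness, and from 1) to 3) *)

Section Interaction.
Variables (G : zmodType) (le : rel G).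
Hypothesis leG : tot_ord_abelian_group le.
Local Notation nonneg x := (le 0 x).
Local Notation action := (action star norm le).
Local Notation interaction := (interaction star norm le).
Local Notation complete := (complete_interaction star norm le).

Lemma nonneg0 : nonneg 0.
Proof. by case: leG => refl *; exact: refl. Qed.

Lemma nonneg_add x y : nonneg x -> nonneg y -> nonneg (x + y).
Proof.
case: leG => _ _ trans _ mono x0 y0; apply: (trans _ y) => //.
by have := mono 0 x y x0; rewrite add0r.
Qed.

Lemma nonneg_sub x y : le x y -> nonneg (y - x).
Proof.
by case: leG => _ _ _ _ mono xy; have := mono x y (- x) xy; rewrite subrr.
Qed.

Lemma interaction_sym V H : interaction V H -> interaction H V.
Proof. by case=> aV aH VH; split=> // x /VH[]. Qed.

Lemma action_bounded V x : action V -> nonneg x -> bounded_positive (V x).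
Proof. by case=> Vb _ _ /Vb. Qed.

Lemma interaction_unitl V H x : interaction V H -> nonneg x ->
  forall a, V x 1 * V x a = V x a.
Proof. by case=> _ _ VH /VH[VHV _ VM _] a; exact: (pair_unitl _ _ VHV VM). Qed.

Lemma interaction_unitr V H x : interaction V H -> nonneg x ->
  forall a, V x a * V x 1 = V x a.
Proof. by case=> _ _ VH /VH[VHV _ VM _] a; exact: (pair_unitr _ _ VHV VM). Qed.

Lemma interaction_projection V H x : interaction V H -> nonneg x ->
  projection star (V x 1).
Proof.
case=> aV _ VH x0; have [VHV _ VM _] := VH _ x0.
exact: (pair_projection _ _ (action_bounded _ _ aV x0) VHV VM).
Qed.

Lemma interaction_map_unit V H x : interaction V H -> nonneg x ->
  V x (H x 1) = V x 1.
Proof.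
move=> iVH x0; have [_ _ /(_ _ x0)[VHV HVH VM HM]] := iVH.
have iHV := interaction_sym _ _ iVH.
exact: (pair_map_unit _ _ VHV VM (interaction_unitl _ _ _ iHV x0)).
Qed.

Lemma interaction_hereditary V H x : interaction V H -> nonneg x ->
  hereditary_Cstar_subalgebra star norm (range (H x)) ->
  forall a, H x (V x a) = H x 1 * a * H x 1.
Proof.
move=> iVH x0 hH; have [_ _ /(_ _ x0)[VHV HVH VM _]] := iVH.
have iHV := interaction_sym _ _ iVH.
apply: (hereditary_complete _ _ VHV HVH VM (interaction_unitl _ _ _ iHV x0)).
apply: corner_sub_hereditary => //; first exact: interaction_projection iHV x0.
by exists 1.
Qed.

Lemma complete_sym V H : complete V H -> complete H V.
Proof.
case=> iVH HV VH comm; split => //; first exact: interaction_sym.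
by move=> x y x0 y0; rewrite comm.
Qed.

Lemma complete_interaction_range V H x : complete V H -> nonneg x ->
  forall y, range (V x) y <-> V x 1 * y * V x 1 = y.
Proof.
case=> [[_ _ VH] _ VHc _] x0 y; have [VHV _ VM _] := VH _ x0.
by apply: (complete_range _ _ VHV VM) => a; exact: VHc.
Qed.

Lemma complete_interactionE V H :
  complete V H <-> cond2 star norm le V H.
Proof.
split=> [cVH|[iVH her comm]].
  have cHV := complete_sym _ _ cVH; have [iVH _ _ comm] := cVH.
  split=> // [x x0|x y x0 y0]; last by rewrite comm.
  split; [apply: (hereditary_corner (V x 1))|apply: (hereditary_corner (H x 1))].
  - exact: interaction_projection iVH x0.
  - exact: complete_interaction_range cVH x0.
  - exact: interaction_projection (interaction_sym _ _ iVH) x0.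
  - exact: complete_interaction_range cHV x0.
split=> // [x a x0|x a x0|x y x0 y0]; last by rewrite comm.
- by apply: (interaction_hereditary V H) => //; case: (her _ x0).
- apply: (interaction_hereditary H V) => //; first exact: interaction_sym.
  by case: (her _ x0).
Qed.

(** H_x(1) K_x(1) H_x(1) and H_x(1) lie in the range of H_x, and V_x maps both to V_x(1).
    Injectivity equates them and [projection_sandwich] concludes. *)
Lemma complete_unit_le V H K x : complete V H -> complete V K -> nonneg x ->
  K x 1 * H x 1 = H x 1.
Proof.
move=> cVH cVK x0; have [iVH _ _ _] := cVH; have [iVK _ _ _] := cVK.
have pH := interaction_projection _ _ _ (interaction_sym _ _ iVH) x0.
have pK := interaction_projection _ _ _ (interaction_sym _ _ iVK) x0.
have [_ _ /(_ _ x0)[VHV HVH VM _]] := iVH.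
have r1 : range (H x) (H x 1) by exists 1.
apply: projection_sandwich => //; apply: (pair_inj _ _ HVH) => //.
  apply/(complete_interaction_range _ _ _ (complete_sym _ _ cVH) x0).
  by apply/cornerP => //; exists (K x 1).
rewrite VM; last by right.
rewrite VM; last by left.
rewrite (interaction_map_unit _ _ _ iVH x0) (interaction_map_unit _ _ _ iVK x0).
by rewrite !(interaction_unitl _ _ _ iVH x0).
Qed.

(** Using [complete_unit_le] both ways, H_x(1) = K_x(1). So H_x(a) and K_x(a) lie in one corner on
    which V_x is injective, and both map to V_x(1) a V_x(1). *)
Lemma complete_interaction_unique V H K x a : complete V H -> complete V K ->
  nonneg x -> H x a = K x a.
Proof.
move=> cVH cVK x0; have [iVH _ VHc _] := cVH; have [iVK _ VKc _] := cVK.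
have iHV := interaction_sym _ _ iVH; have iKV := interaction_sym _ _ iVK.
have [_ sH] := interaction_projection _ _ _ iHV x0.
have [_ sK] := interaction_projection _ _ _ iKV x0.
have HK : H x 1 = K x 1.
  have := congr1 star (complete_unit_le _ _ _ _ cVK cVH x0).
  by rewrite starM sH sK (complete_unit_le _ _ _ _ cVH cVK x0).
have [_ _ /(_ _ x0)[_ HVH _ _]] := iVH.
apply: (pair_inj _ _ HVH); [by exists a| |by rewrite VHc// VKc].
apply/(complete_interaction_range _ _ _ (complete_sym _ _ cVH) x0); rewrite HK.
by rewrite (interaction_unitl _ _ _ iKV x0) (interaction_unitr _ _ _ iKV x0).
Qed.

Lemma complete_cond3 V H : complete V H ->
  cond3i star le V /\ cond3ii star le V (fun x => H x 1).
Proof.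
move=> cVH; have cHV := complete_sym _ _ cVH; have [iVH HVc VHc comm] := cVH.
have iHV := interaction_sym _ _ iVH; have [aV aH VH] := iVH.
have pV x : nonneg x -> projection star (V x 1).
  exact: interaction_projection iVH.
have pH x : nonneg x -> projection star (H x 1).
  exact: interaction_projection iHV.
have cornH x y : nonneg x -> corner (H x 1) y <-> range (H x) y.
  move=> x0; rewrite (complete_interaction_range _ _ _ cHV x0).
  exact: cornerP (pH _ x0).
split=> [x x0|].
  split=> [|y]; first exact: pV.
  rewrite (complete_interaction_range _ _ _ cVH x0).
  by apply: iff_sym; exact: cornerP (pV _ x0).
split=> [||x y x0 y0|x y x0 y0|x x0]; first exact: pH.
(* Monotonicity: H_y(1) = H_x(H_{y-x}(1)) is absorbed by H_x(1). *)
- move=> x y x0 y0 xy; apply: projection_cle; [exact: pH|exact: pH|].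
  have [_ _ HD] := aH.
  have -> : H y 1 = H x (H (y - x) 1).
    by rewrite HD ?nonneg_sub//; congr (H _ 1); rewrite addrC subrK.
  exact: interaction_unitl iHV x0 _.
- by rewrite comm.
(* V_x(H_x(H_y(1))) is V_x(1) H_y(1) V_x(1), and the two projections commute. *)
- have [_ _ HD] := aH; rewrite -HD// VHc// -mulrA comm// mulrA.
  by case: (pV _ x0) => ->.
- have [VHV HVH VM HM] := VH _ x0.
  have Vb := action_bounded _ _ aV x0.
  do 5?split.
  + by move=> a _; exists a.
  + by move=> a b /cornH-/(_ x0) Ha /cornH-/(_ x0) Hb; exact: (pair_inj _ _ HVH).
  + move=> y [a ->]; exists (H x (V x a)); last by rewrite VHV.
    by apply/cornH => //; exists (V x a).
  + by move=> c a b _ _; exact: bounded_positive_lin.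
  + by move=> a b /cornH-/(_ x0) Ha _; apply: VM; left.
  + move=> a _; apply: positive_map_star; first exact: bounded_positive_lin.
    exact: bounded_positive_pos.
Qed.

(** * From 3) to a complete interaction *)

Section Cond3.
Variables (V : G -> A -> A) (P : G -> A).
Hypotheses (aV : action V) (V3i : cond3i star le V) (V3ii : cond3ii star le V P).

Lemma cond3_projV x : nonneg x -> projection star (V x 1).
Proof. by move=> /V3i[]. Qed.

Lemma cond3_projP x : nonneg x -> projection star (P x).
Proof. by case: V3ii => pP _ _ _ _ /pP. Qed.

Lemma cond3_range x y : nonneg x -> range (V x) y <-> V x 1 * y * V x 1 = y.
Proof.
by move=> x0; have [pV ->] := V3i _ x0; exact: cornerP.
Qed.

Lemma cond3_lin x : nonneg x ->
  forall (c : R[i]) a b, V x (c *: a + b) = c *: V x a + V x b.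
Proof. by move=> x0; apply: bounded_positive_lin; exact: action_bounded. Qed.

Lemma cond3_pos x : nonneg x -> forall a, pos a -> pos (V x a).
Proof. by move=> x0; apply: bounded_positive_pos; exact: action_bounded. Qed.

Lemma cond3_star x a : nonneg x -> V x (star a) = star (V x a).
Proof.
move=> x0; apply: positive_map_star; [exact: cond3_lin|exact: cond3_pos].
Qed.

Lemma cond3_inj x u v : nonneg x -> P x * u * P x = u -> P x * v * P x = v ->
  V x u = V x v -> u = v.
Proof.
move=> x0 Pu Pv; have [_ _ _ _ /(_ _ x0)[_ [inj _]]] := V3ii.
have pP := cond3_projP _ x0.
by apply: inj; apply/cornerP.
Qed.

(** As V_0 is the identity, surjectivity puts 1 in the corner of P_0. *)
Lemma cond3_P0 : P 0 = 1.
Proof.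
have [PP sP] := cond3_projP _ nonneg0.
have [_ _ _ _ /(_ _ nonneg0)[_ [_ [surj _]]]] := V3ii.
have [_ V0 _] := aV.
have [|a [b ->]] := surj 1; first by exists 1; rewrite V0.
rewrite V0 => e; have := congr1 (fun u => P 0 * u) e.
by rewrite mulr1 !mulrA PP -e.
Qed.

Lemma cond3_VP x : nonneg x -> V x (P x) = V x 1.
Proof.
move=> x0; have [_ _ _ b _] := V3ii.
by rewrite -[x in P x]addr0 b ?nonneg0// cond3_P0 mulr1.
Qed.

(** V_x kills the projection 1 - P_x, hence by [positive_map_kernel] every (1 - P_x) a. *)
Lemma cond3_VPl x a : nonneg x -> V x (P x * a) = V x a.
Proof.
move=> x0; have lin := cond3_lin _ x0.
have q := projection_compl _ (cond3_projP _ x0).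
have Vq : V x (1 - P x) = 0 by rewrite linear_mapB// cond3_VP// subrr.
have := positive_map_kernel _ lin (cond3_pos _ x0) _ q Vq a.
rewrite mulrBl mul1r linear_mapB// => /eqP; rewrite subr_eq0 => /eqP.
by move=> ->.
Qed.

Lemma cond3_VPr x a : nonneg x -> V x (a * P x) = V x a.
Proof.
move=> x0; have [_ sP] := cond3_projP _ x0.
by rewrite -[LHS]starK -cond3_star// starM sP cond3_VPl// cond3_star// starK.
Qed.

Lemma cond3_isoM x a b : nonneg x -> P x * a * P x = a -> P x * b * P x = b ->
  V x (a * b) = V x a * V x b.
Proof.
move=> x0 Pa Pb; have [_ _ _ _ /(_ _ x0)[_ [_ [_ [_ [isoM _]]]]]] := V3ii.
by apply: isoM; apply/cornerP => //; exact: cond3_projP.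
Qed.

Lemma cond3_cut x a : nonneg x -> P x * (P x * a * P x) * P x = P x * a * P x.
Proof.
by move=> x0; apply/cornerP; [exact: cond3_projP|exists a].
Qed.

(** Since a = a P_x, b can be replaced by P_x b P_x, where the isomorphism is multiplicative; V_x
    does not see these cuts. *)
Lemma cond3_Ml x a b : nonneg x -> P x * a * P x = a -> V x (a * b) = V x a * V x b.
Proof.
move=> x0 Pa; have pP := cond3_projP _ x0.
rewrite -cond3_VPr// -{1}(corner_mulr _ _ pP Pa).
rewrite -(mulrA a) -(mulrA a) cond3_isoM ?cond3_cut//.
by rewrite cond3_VPr// cond3_VPl.
Qed.

Lemma cond3_Mr x a b : nonneg x -> P x * b * P x = b -> V x (a * b) = V x a * V x b.
Proof.
move=> x0 Pb; have [_ sP] := cond3_projP _ x0.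
have sPb : P x * star b * P x = star b.
  by have := congr1 star Pb; rewrite !starM sP mulrA.
rewrite -[LHS]starK -cond3_star// starM cond3_Ml// starM -!cond3_star//.
by rewrite !starK.
Qed.

Lemma cond3_P_le x y : nonneg x -> nonneg y ->
  P (x + y) * P x = P (x + y) /\ P x * P (x + y) = P (x + y).
Proof.
move=> x0 y0; have xy0 := nonneg_add _ _ x0 y0; have [_ dec _ _ _] := V3ii.
apply: cle_projection; [exact: cond3_projP..|].
apply: dec => //; case: leG => _ _ _ _ mono.
by have := mono 0 y x y0; rewrite add0r addrC.
Qed.

Lemma cond3_inverse : exists H : G -> A -> A, forall x a, nonneg x ->
  P x * H x a * P x = H x a /\ V x (H x a) = V x 1 * a * V x 1.
Proof.
(* Choice runs over pairs (x, a); an x that is not nonnegative gets the default value 0. *)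
have [z|h hP] := @choice (G * A) A (fun z b => nonneg z.1 ->
    P z.1 * b * P z.1 = b /\ V z.1 b = V z.1 1 * z.2 * V z.1 1).
  have [x0|] := boolP (nonneg z.1); last by exists 0.
  have [_ _ _ _ /(_ _ x0)[_ [_ [surj _]]]] := V3ii.
  have [|b /cornerP-/(_ (cond3_projP _ x0)) Pb ->] := surj (V z.1 1 * z.2 * V z.1 1).
    apply/cond3_range => //.
    by apply/cornerP; [exact: cond3_projV|exists z.2].
  by exists b.
by exists (fun x a => h (x, a)) => x a x0; exact: (hP (x, a)).
Qed.

Section Inverse.
Variable H : G -> A -> A.
Hypotheses (HP : forall x a, nonneg x -> P x * H x a * P x = H x a)
  (VH : forall x a, nonneg x -> V x (H x a) = V x 1 * a * V x 1).

(** V_x is injective on the corner of P_x, so identities for H reduce to membership in that corner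
    and an equality of images under V_x. *)
Lemma inverse_unique x a b : nonneg x -> P x * b * P x = b ->
  V x b = V x 1 * a * V x 1 -> H x a = b.
Proof. by move=> x0 Pb Vb; apply: (cond3_inj x) => //; rewrite ?HP ?VH. Qed.

Lemma inverse_lin x : nonneg x ->
  forall (c : R[i]) a b, H x (c *: a + b) = c *: H x a + H x b.
Proof.
move=> x0 c a b; apply: inverse_unique => //.
  by rewrite mulrDr mulrDl -scalerAr -scalerAl !HP.
by rewrite cond3_lin// !VH// mulrDr mulrDl -scalerAr -scalerAl.
Qed.

(** For p = V_x(1), p r^2 p is s^2 with s positive in the corner of p. As V_x is multiplicative on
    the corner of P_x, H_x(r^2) is the square of the self-adjoint H_x(s). *)
Lemma inverse_pos x a : nonneg x -> pos a -> pos (H x a).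
Proof.
move=> x0 /pos_sqrt[r [[sr _] <- _]]; have [pp sp] := cond3_projV _ x0.
set p := V x 1 in pp sp.
have pP := cond3_projP _ x0; have [PP sP] := pP.
have [s [[ss _] ssE _]] : exists s, [/\ pos s, s * s = p * (r * r) * p
    & forall b, p * (r * r) * p * b = b * (p * (r * r) * p) -> s * b = b * s].
  apply: pos_sqrt; have -> : p * (r * r) * p = star (r * p) * (r * p).
    by rewrite starM sr sp !mulrA.
  exact: pos_starM.
have [qq sq] := projection_compl _ (conj pp sp).
(* Since (1 - p) s^2 = 0, the star square of s (1 - p) vanishes; this puts s in the corner of p. *)
have sq0 : s * (1 - p) = 0.
  apply: starM_eq0; rewrite starM sq ss mulrA -(mulrA (1 - p)) ssE.
  have -> : (1 - p) * (p * (r * r) * p) = (p - p * p) * (r * r) * p by ncring.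
  by rewrite pp subrr !mul0r.
have sp1 : s * p = s.
  by move: sq0; rewrite mulrBr mulr1 => /eqP; rewrite subr_eq0 eq_sym => /eqP.
have sp2 : p * s = s by have := congr1 star sp1; rewrite starM sp ss.
have -> : H x (r * r) = H x s * H x s.
  apply: inverse_unique => //.
    by rewrite mulrA (corner_mull _ _ pP (HP _ _ x0)) -mulrA
               (corner_mulr _ _ pP (HP _ _ x0)).
  by rewrite cond3_isoM ?HP// !VH// -/p sp2 sp1 ssE.
apply: pos_sqr; apply/esym/inverse_unique => //.
  by have := congr1 star (HP x s x0); rewrite !starM sP mulrA.
by rewrite cond3_star// VH// -/p !starM sp ss mulrA.
Qed.

Lemma inverse_one x : nonneg x -> H x 1 = P x.
Proof.
move=> x0; have [PP _] := cond3_projP _ x0; have [pp _] := cond3_projV _ x0.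
by apply: inverse_unique => //; rewrite ?PP// cond3_VP// mulr1 pp.
Qed.

Lemma inverse_bounded x : nonneg x -> bounded_positive (H x).
Proof.
move=> x0; split; first exact: inverse_lin.
  apply: positive_map_bounded; first exact: inverse_lin.
    by move=> a; exact: inverse_pos.
  by rewrite inverse_one//; apply/projection_pos/projection_compl/cond3_projP.
by move=> a /positiveP a0; apply/positiveP; exact: inverse_pos.
Qed.

(** For c = H_x(H_y(a)), it suffices that c lies in the corner of P_{x+y} and that V_{x+y}(c) =
    V_y(V_x(c)) equals V_{x+y}(1) a V_{x+y}(1). *)
Lemma inverse_add x y a : nonneg x -> nonneg y -> H x (H y a) = H (x + y) a.
Proof.
move=> x0 y0; have xy0 := nonneg_add _ _ x0 y0; have [_ _ VD] := aV.
have [_ _ comm VP _] := V3ii.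
have pPx := cond3_projP _ x0; have pPy := cond3_projP _ y0.
have [ppx _] := cond3_projV _ x0.
have [PxyPx PxPxy] := cond3_P_le _ _ x0 y0.
have Hya := HP y a y0.
have Pxyc : P x * P (x + y) * P x = P (x + y) by rewrite PxPxy PxyPx.
set c := H x (H y a); have Pc : P x * c * P x = c by exact: HP.
have Vc : V x c = V x 1 * H y a * V x 1 by exact: VH.
(* Compare images under V_x, which sends P_{x+y} to V_x(1) P_y; the factor P_y is absorbed by
   H_y(a). *)
have cl : P (x + y) * c = c.
  apply: (cond3_inj x) => //.
    by rewrite mulrA PxPxy -mulrA (corner_mulr _ _ pPx Pc).
  rewrite cond3_isoM// VP// Vc !mulrA -(mulrA (V x 1)) -comm// !mulrA ppx.
  by rewrite -(mulrA (V x 1)) (corner_mull _ _ pPy Hya).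
have cr : c * P (x + y) = c.
  apply: (cond3_inj x) => //.
    by rewrite mulrA (corner_mull _ _ pPx Pc) -mulrA PxyPx.
  rewrite cond3_isoM// VP// Vc !mulrA -(mulrA _ (V x 1) (V x 1)) ppx.
  by rewrite -mulrA comm// mulrA -(mulrA (V x 1)) (corner_mulr _ _ pPy Hya).
apply/esym/inverse_unique => //; first by rewrite cl cr.
have Vyx1 : V y (V x 1) = V (x + y) 1 by rewrite VD// addrC.
have PyV : P y * V x 1 = V x 1 * P y by rewrite comm.
(* V_x(1) commutes with P_y, so the product stays in the corner where V_y is multiplicative. *)
have corn : P y * (V x 1 * H y a) * P y = V x 1 * H y a.
  rewrite mulrA PyV -mulrA -mulrA (corner_mulr _ _ pPy Hya).
  by rewrite (corner_mull _ _ pPy Hya).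
rewrite addrC -VD// Vc cond3_Ml// cond3_Mr// Vyx1 VH// (addrC y).
have pVy := cond3_projV _ y0.
(* Being V_y(V_x(1)), V_{x+y}(1) absorbs the factors V_y(1) that come from V_y(H_y(a)). *)
have Vxy_corner : V y 1 * V (x + y) 1 * V y 1 = V (x + y) 1.
  by apply/cond3_range => //; rewrite -Vyx1; exists (V x 1).
rewrite !mulrA (corner_mulr _ _ pVy Vxy_corner).
by rewrite -mulrA (corner_mull _ _ pVy Vxy_corner).
Qed.

Lemma inverse_action : action H.
Proof.
split=> [x|a|x y a]; [exact: inverse_bounded| |exact: inverse_add].
have [_ V0 _] := aV; apply: inverse_unique; first exact: nonneg0.
  by rewrite cond3_P0 mul1r mulr1.
by rewrite !V0 mul1r mulr1.
Qed.

Lemma inverse_HV x a : nonneg x -> H x (V x a) = P x * a * P x.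
Proof.
move=> x0; apply: inverse_unique => //; first exact: cond3_cut.
rewrite cond3_VPr// cond3_VPl//.
by apply/esym/cond3_range => //; exists a.
Qed.

Lemma inverse_interaction : interaction V H.
Proof.
split=> // [|x x0]; first exact: inverse_action.
have pP := cond3_projP _ x0; have pV := cond3_projV _ x0; have [pp _] := pV.
split.
- by move=> a; rewrite VH//; apply/cond3_range => //; exists a.
- by move=> a; rewrite inverse_HV// HP.
- by move=> a b [[c ->]|[c ->]]; [apply: cond3_Ml|apply: cond3_Mr]; rewrite ?HP.
- move=> a b rab; apply: inverse_unique => //.
    by rewrite mulrA (corner_mull _ _ pP (HP _ _ x0)) -mulrA
               (corner_mulr _ _ pP (HP _ _ x0)).
  rewrite cond3_isoM ?HP// !VH// !mulrA -(mulrA _ (V x 1) (V x 1)) pp.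
  case: rab => /cond3_range-/(_ x0) Va.
    by rewrite -(mulrA (V x 1) a) (corner_mulr _ _ pV Va).
  by rewrite -(mulrA _ (V x 1) b) (corner_mull _ _ pV Va).
Qed.

Lemma inverse_complete : complete V H.
Proof.
split=> [|x a x0|x a x0|x y x0 y0]; first exact: inverse_interaction.
- by rewrite inverse_HV// inverse_one.
- exact: VH.
- by have [_ _ comm _ _] := V3ii; rewrite inverse_one// comm.
Qed.

End Inverse.

Lemma cond3_complete :
  exists2 H, complete V H & forall x, nonneg x -> H x 1 = P x.
Proof.
have [H HE] := cond3_inverse; exists H.
  by apply: inverse_complete => x a x0; case: (HE x a x0).
by move=> x x0; apply: inverse_one => // y a y0; case: (HE y a y0).
Qed.

End Cond3.
End Interaction.
End CstarAlgebra.

Theorem theorem3p5 (R : realType) (A : algType (R[i])) (star : A -> A)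
    (norm : A -> R) (G : zmodType) (le : rel G) (V : G -> A -> A) :
  tot_ord_abelian_group le ->
  unital_Cstar_algebra star norm ->
  action star norm le V ->
  (* 1) <-> 2) *)
  ((exists H, complete_interaction star norm le V H) <->
   (exists H, cond2 star norm le V H)) /\
  (* 2) <-> 3) *)
  ((exists H, cond2 star norm le V H) <->
   (cond3i star le V /\ exists P, cond3ii star le V P)) /\
  (* uniqueness of H (in 1) and 2)) *)
  (forall H1 H2,
     complete_interaction star norm le V H1 \/ cond2 star norm le V H1 ->
     complete_interaction star norm le V H2 \/ cond2 star norm le V H2 ->
     forall x a, le 0 x -> H1 x a = H2 x a) /\
  (* uniqueness of P in 3) *)
  (forall P1 P2,
     cond3i star le V -> cond3ii star le V P1 -> cond3ii star le V P2 ->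
     forall x, le 0 x -> P1 x = P2 x) /\
  (* relation between H and P: P_x = H_x(1), H_x(a) = V_x^{-1}(V_x(1) a V_x(1)) *)
  (forall H P,
     complete_interaction star norm le V H \/ cond2 star norm le V H ->
     cond3i star le V -> cond3ii star le V P ->
     forall x, le 0 x ->
       P x = H x 1 /\
       (forall a, corner (P x) (H x a) /\ V x (H x a) = V x 1 * a * V x 1)).
Proof.
move=> leG Cstar aV.
have E := complete_interactionE _ _ _ _ Cstar _ le V.
have C H : complete_interaction star norm le V H \/ cond2 star norm le V H ->
    complete_interaction star norm le V H.
  by case=> // /E.
have uniq H1 H2 x a : complete_interaction star norm le V H1 ->
    complete_interaction star norm le V H2 -> le 0 x -> H1 x a = H2 x a.
  exact: (complete_interaction_unique _ _ _ _ Cstar).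
have from3 P : cond3i star le V -> cond3ii star le V P ->
    exists2 H, complete_interaction star norm le V H
             & forall x, le 0 x -> H x 1 = P x.
  exact: (cond3_complete _ _ _ _ Cstar _ _ leG).
split; first by split=> -[H /E HH]; exists H.
split.
  split=> [[H /E /(complete_cond3 _ _ _ _ Cstar _ _ leG)[V3i V3ii]]|].
    by split=> //; exists (fun x => H x 1).
  by move=> [V3i [P V3ii]]; have [H /E HH _] := from3 P V3i V3ii; exists H.
split; first by move=> H1 H2 /C c1 /C c2 x a; exact: uniq.
split.
  (* Each family in 3) is H_x(1) for some complete interaction, so uniqueness of H transfers to
     P. *)
  move=> P1 P2 V3i /(from3 _ V3i)[H1 c1 e1] /(from3 _ V3i)[H2 c2 e2] x x0.
  by rewrite -e1// -e2//; exact: uniq.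
move=> H P /C cVH V3i /(from3 _ V3i)[K cVK KP] x x0.
have [iVH _ VHc _] := cVH; have iHV := interaction_sym _ _ _ _ _ _ _ _ iVH.
have PH : P x = H x 1 by rewrite -KP//; exact: uniq.
split=> // a; split; last exact: VHc.
exists (H x a); rewrite PH.
by rewrite (interaction_unitl _ _ _ _ _ _ _ _ _ iHV x0)
           (interaction_unitr _ _ _ _ _ _ _ _ _ iHV x0).
Qed.
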